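(* Let $q,a,b$ be nonzero complex numbers with $|q|<1$ and $\max\{|ab/q|,|a|,|b|\}<1$. Then $$\frac{(q,ab/q;q)_\infty}{(a,b;q)_\infty}\;{}_3\phi_2\left(\begin{matrix}q/a,\,q/b,\,q\\ -q,\,-q\end{matrix};q,ab/q\right)=1+4\sum_{n=1}^{\infty}\frac{1}{1+q^{n}}\,\frac{(q/a,q/b;q)_n}{(a,b;q)_n}(-ab)^nq^{(n^2-n)/2}.$$
   Context: Notation: $(x;q)_0=1$, $(x;q)_n=\prod_{k=0}^{n-1}(1-xq^k)$, $(x;q)_\infty=\prod_{k=0}^\infty(1-xq^k)$, $(x_1,\dots,x_k;q)_n=(x_1;q)_n\cdots(x_k;q)_n$ (also for $n=\infty$), and $${}_3\phi_2\left(\begin{matrix}A_1,A_2,A_3\\ B_1,B_2\end{matrix};q,z\right)=\sum_{n=0}^\infty\frac{(A_1,A_2,A_3;q)_n}{(q,B_1,B_2;q)_n}z^n .$$ *)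

(* Defs.v *)
From Stdlib Require Import Reals.
From Coquelicot Require Export Coquelicot.
Open Scope C_scope.

(* Stdlib/Coquelicot reals and complex numbers.  Coquelicot's [Series] and
   [Lim_seq] are real-valued; limits and sums in [C] are taken here with
   [iota], which returns the unique point satisfying a predicate.  It is only
   meaningful when the limit exists, i.e. under [ex_qpoch_inf], [ex_series]. *)

Definition C_Series (u : nat -> C) : C :=
  @iota C_CompleteNormedModule (@is_series C_AbsRing C_NormedModule u).

Fixpoint qpoch (x q : C) (n : nat) : C :=
  match n with
  | O => 1
  | S k => qpoch x q k * (1 - x * q ^ k)
  end.

Definition is_qpoch_inf (x q l : C) : Prop :=
  filterlim (qpoch x q) eventually (@locally C_NormedModule l).

Definition ex_qpoch_inf (x q : C) : Prop := exists l : C, is_qpoch_inf x q l.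

Definition qpoch_inf (x q : C) : C :=
  @iota C_CompleteNormedModule (is_qpoch_inf x q).

Definition phi32_term (A1 A2 A3 B1 B2 q z : C) (n : nat) : C :=
  (qpoch A1 q n * qpoch A2 q n * qpoch A3 q n)
    / (qpoch q q n * qpoch B1 q n * qpoch B2 q n) * z ^ n.

Definition phi32 (A1 A2 A3 B1 B2 q z : C) : C :=
  C_Series (phi32_term A1 A2 A3 B1 B2 q z).

(* [(n ^ 2 - n) / 2] is computed in [nat]; the subtraction does not truncate
   and the division is exact. *)
Definition rhs_term (q a b : C) (n : nat) : C :=
  / (1 + q ^ n)
    * ((qpoch (q / a) q n * qpoch (q / b) q n) / (qpoch a q n * qpoch b q n))
    * (- (a * b)) ^ n * q ^ ((n ^ 2 - n) / 2)%nat.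

(* Main.v *)
(* Bailey's lemma with parameters A = q/a, B = q/b and argument z = ab/q,
   applied to the Bailey pair relative to 1
     alpha_0 = 1,  alpha_r = 4 (-1)^r q^(r(r+1)/2) / (1 + q^r),
     beta_n = 1 / (-q;q)_n^2 = sum_(r <= n) alpha_r / ((q;q)_(n-r) (q;q)_(n+r)).
   Inserting this sum for beta_n in the 3phi2 series and exchanging the two
   summations leaves, for each r, a series in n that is evaluated by the q-Gauss
   sum.  The q-Gauss sum follows from the contiguous relation between z and zq
   by letting z q^k tend to 0; the Bailey pair is proved by induction on n, the
   difference of consecutive sums being a telescoping sum in r. *)

Require Import Defs.
From Stdlib Require Import Reals Arith Lra Lia.
From Coquelicot Require Import Coquelicot.
Open Scope C_scope.

(** * Limits and series of complex sequences *)

Definition csum (u : nat -> C) (n : nat) : C := @sum_n C_NormedModule u n.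
Notation cseries := (@is_series C_AbsRing C_NormedModule).

(** Convergence in [C] is stated as a real limit of moduli, so that squeezing and the limit rules
    for real sequences apply directly. *)
Definition limC (u : nat -> C) (l : C) : Prop :=
  is_lim_seq (fun n => Cmod (u n - l)) 0%R.

Lemma limC_filterlim (u : nat -> C) (l : C) :
  limC u l <-> filterlim u eventually (@locally C_NormedModule l).
Proof.
split.
- intros H. apply filterlim_locally_ball_norm. intros eps.
  apply is_lim_seq_spec in H. destruct (H eps) as [N HN].
  exists N. intros n Hn. specialize (HN n Hn).
  unfold ball_norm. change (Cmod (u n - l) < eps)%R.
  rewrite Rminus_0_r, Rabs_pos_eq in HN by apply Cmod_ge_0. exact HN.
- intros H. apply is_lim_seq_spec. intros eps.
  destruct (proj1 (filterlim_locally_ball_norm u l) H eps) as [N HN].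
  exists N. intros n Hn. specialize (HN n Hn).
  rewrite Rminus_0_r, Rabs_pos_eq by apply Cmod_ge_0. exact HN.
Qed.

Lemma limC_unique (u : nat -> C) (l m : C) : limC u l -> limC u m -> l = m.
Proof.
rewrite !limC_filterlim.
exact (@filterlim_locally_unique nat C_AbsRing C_NormedModule eventually _ u l m).
Qed.

Lemma limC_squeeze (u : nat -> C) (l : C) (e : nat -> R) :
  (forall n, Cmod (u n - l) <= e n)%R -> is_lim_seq e 0%R -> limC u l.
Proof.
intros H He. apply is_lim_seq_le_le with (2 := is_lim_seq_const 0) (3 := He).
intros n. split; [apply Cmod_ge_0 | apply H].
Qed.

Lemma limC_ext (u v : nat -> C) (l : C) :
  (forall n, u n = v n) -> limC u l -> limC v l.
Proof.
intros H. apply is_lim_seq_ext. intros n. now rewrite H.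
Qed.

Lemma limC_const (l : C) : limC (fun _ => l) l.
Proof.
apply limC_squeeze with (fun _ => 0%R); [|apply is_lim_seq_const].
intros _. replace (l - l) with (RtoC 0) by ring. rewrite Cmod_0. lra.
Qed.

Lemma limC_S (u : nat -> C) (l : C) : limC u l <-> limC (fun n => u (S n)) l.
Proof. exact (is_lim_seq_incr_1 (fun n => Cmod (u n - l)) 0%R). Qed.

Lemma limC_plus (u v : nat -> C) (l m : C) :
  limC u l -> limC v m -> limC (fun n => u n + v n) (l + m).
Proof.
intros Hu Hv.
apply limC_squeeze with (fun n => Cmod (u n - l) + Cmod (v n - m))%R.
- intros n. replace (u n + v n - (l + m)) with ((u n - l) + (v n - m)) by ring.
  apply Cmod_triangle.
- replace 0%R with (0 + 0)%R by ring. now apply is_lim_seq_plus'.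
Qed.

Lemma limC_mult (u v : nat -> C) (l m : C) :
  limC u l -> limC v m -> limC (fun n => u n * v n) (l * m).
Proof.
intros Hu Hv.
apply limC_squeeze with (fun n => Cmod (u n - l) * Cmod (v n - m)
  + (Cmod l * Cmod (v n - m) + Cmod (u n - l) * Cmod m))%R.
- intros n. replace (u n * v n - l * m)
    with ((u n - l) * (v n - m) + (l * (v n - m) + (u n - l) * m)) by ring.
  rewrite <- !Cmod_mult.
  eapply Rle_trans; [apply Cmod_triangle|].
  apply Rplus_le_compat_l, Cmod_triangle.
- replace 0%R with (0 * 0 + (Cmod l * 0 + 0 * Cmod m))%R by ring.
  repeat (apply is_lim_seq_plus' || apply is_lim_seq_mult');
    try assumption; apply is_lim_seq_const.
Qed.

Lemma limC_scal (c : C) (u : nat -> C) (l : C) :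
  limC u l -> limC (fun n => c * u n) (c * l).
Proof. apply limC_mult, limC_const. Qed.

Lemma limC_minus (u v : nat -> C) (l m : C) :
  limC u l -> limC v m -> limC (fun n => u n - v n) (l - m).
Proof.
intros Hu Hv. replace (l - m) with (l + - (1) * m) by ring.
apply limC_ext with (fun n => u n + - (1) * v n); [intros n; ring|].
now apply limC_plus, limC_scal.
Qed.

Lemma limC_Cmod (u : nat -> C) (l : C) :
  limC u l -> is_lim_seq (fun n => Cmod (u n)) (Cmod l).
Proof.
intros Hu. apply limC_filterlim in Hu.
apply (filterlim_comp _ _ _ u (@norm C_AbsRing C_NormedModule) _ _ _ Hu).
exact (@filterlim_norm C_AbsRing C_NormedModule l).
Qed.

Lemma limC_dominated_0 (u : nat -> C) (M r : R) :
  (0 <= r < 1)%R -> (forall n, Cmod (u n) <= M * r ^ n)%R -> limC u 0.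
Proof.
intros Hr Hu. apply limC_squeeze with (fun n => M * r ^ n)%R.
- intros n. now replace (u n - 0) with (u n) by ring.
- replace 0%R with (M * 0)%R by ring.
  apply is_lim_seq_mult'; [apply is_lim_seq_const|].
  apply is_lim_seq_geom. rewrite Rabs_pos_eq; lra.
Qed.

Lemma cseries_limC (u : nat -> C) (l : C) : cseries u l <-> limC (csum u) l.
Proof. symmetry. apply limC_filterlim. Qed.

Lemma C_Series_correct (u : nat -> C) (l : C) : cseries u l -> C_Series u = l.
Proof.
intros H.
apply (@iota_filterlim_locally C_AbsRing C_CompleteNormedModule nat eventually _
  (csum u) l H).
Qed.

Lemma csum_S (u : nat -> C) (n : nat) : csum u (S n) = csum u n + u (S n).
Proof. exact (sum_Sn u n). Qed.

Lemma csum_0 (u : nat -> C) : csum u 0 = u 0%nat.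
Proof. exact (sum_O u). Qed.

Lemma csum_ext (u v : nat -> C) (n : nat) :
  (forall k, (k <= n)%nat -> u k = v k) -> csum u n = csum v n.
Proof. exact (@sum_n_ext_loc C_NormedModule u v n). Qed.

Lemma csum_scal (c : C) (u : nat -> C) (n : nat) :
  csum (fun k => c * u k) n = c * csum u n.
Proof.
induction n as [|n IH]; rewrite ?csum_0, ?csum_S; [reflexivity|].
rewrite IH. ring.
Qed.

Lemma csum_minus (u v : nat -> C) (n : nat) :
  csum (fun k => u k - v k) n = csum u n - csum v n.
Proof.
induction n as [|n IH]; rewrite ?csum_0, ?csum_S; [reflexivity|].
rewrite IH. ring.
Qed.

Lemma csum_dominated (u : nat -> C) (M r : R) (n m : nat) :
  (0 <= r < 1)%R -> (forall n, Cmod (u n) <= M * r ^ n)%R ->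
  (Cmod (csum u (n + m) - csum u n) <= M * r ^ S n / (1 - r))%R.
Proof.
intros Hr Hu.
assert (HM : (0 <= M)%R).
{ generalize (Cmod_ge_0 (u 0%nat)) (Hu 0%nat). simpl. lra. }
(* The induction on [m] needs the exact finite geometric sum; the factor [1 - r ^ m] is dropped only
   afterwards. *)
apply Rle_trans with (M * r ^ S n * (1 - r ^ m) / (1 - r))%R.
- induction m as [|m IH].
  + rewrite Nat.add_0_r. replace (csum u n - csum u n) with (RtoC 0) by ring.
    rewrite Cmod_0. simpl. apply Req_le. field. lra.
  + rewrite Nat.add_succ_r, csum_S.
    replace (csum u (n + m) + u (S (n + m)) - csum u n)
      with ((csum u (n + m) - csum u n) + u (S (n + m))) by ring.
    eapply Rle_trans; [apply Cmod_triangle|].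
    eapply Rle_trans; [apply Rplus_le_compat; [exact IH | apply Hu]|].
    apply Req_le. replace (S (n + m)) with (S n + m)%nat by lia.
    rewrite pow_add. simpl. field. lra.
- unfold Rdiv. rewrite Rmult_assoc.
  assert (0 <= r ^ m)%R by now apply pow_le.
  assert (0 <= r ^ S n)%R by now apply pow_le.
  assert (0 < / (1 - r))%R by (apply Rinv_0_lt_compat; lra).
  assert (0 <= M * r ^ S n)%R by now apply Rmult_le_pos.
  assert ((1 - r ^ m) * / (1 - r) <= / (1 - r))%R by nra.
  nra.
Qed.

Lemma cseries_dominated (u : nat -> C) (M r : R) :
  (0 <= r < 1)%R -> (forall n, Cmod (u n) <= M * r ^ n)%R ->
  exists l, cseries u l.
Proof.
intros Hr Hu.
apply (@ex_series_le C_AbsRing C_CompleteNormedModule u (fun n => M * r ^ n)%R Hu).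
apply (@ex_series_scal R_AbsRing R_NormedModule M (fun n => r ^ n)%R).
exists (/ (1 - r))%R. apply is_series_geom. rewrite Rabs_pos_eq; lra.
Qed.

(** Letting [m] tend to infinity in [csum_dominated]. The explicit constant gives tail estimates
    that are uniform in a parameter, both in the q-Gauss sum and in the interchange of
    summations. *)
Lemma cseries_tail (u : nat -> C) (l : C) (M r : R) (n : nat) :
  (0 <= r < 1)%R -> (forall n, Cmod (u n) <= M * r ^ n)%R -> cseries u l ->
  (Cmod (l - csum u n) <= M * r ^ S n / (1 - r))%R.
Proof.
intros Hr Hu Hl. apply cseries_limC in Hl.
assert (H : limC (fun m => csum u (n + m) - csum u n) (l - csum u n)).
{ apply limC_minus; [|apply limC_const].
  apply (is_lim_seq_ext (fun m => Cmod (csum u (m + n) - l))%R).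
  - intros m. now rewrite Nat.add_comm.
  - now apply (is_lim_seq_incr_n (fun m => Cmod (csum u m - l)) n 0%R). }
apply limC_Cmod in H.
apply (is_lim_seq_le _ _ (Finite _) (Finite _)) with (2 := H)
  (3 := is_lim_seq_const (M * r ^ S n / (1 - r))%R).
intros m. now apply csum_dominated.
Qed.

(** * Bounds and convergence of q-shifted factorials *)

Lemma exp_le_compat (x y : R) : (x <= y)%R -> (exp x <= exp y)%R.
Proof. intros [H | ->]; [left; now apply exp_increasing | apply Rle_refl]. Qed.

(** Each factor satisfies |1 - x q^k| <= 1 + X |q|^k <= exp(X |q|^k), and the exponents add up to a
    geometric sum. The bound depends neither on [n] nor on the particular [x] with |x| <= X. *)
Lemma qpoch_upper (x q : C) (X : R) (n : nat) :
  (Cmod q < 1)%R -> (Cmod x <= X)%R ->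
  (Cmod (qpoch x q n) <= exp (X / (1 - Cmod q)))%R.
Proof.
intros Hq Hx.
assert (Q0 := Cmod_ge_0 q). assert (X0 := Cmod_ge_0 x).
apply Rle_trans with (exp (X * (1 - Cmod q ^ n) / (1 - Cmod q))).
- induction n as [|n IH].
  + simpl. rewrite Cmod_1.
    replace (X * (1 - 1) / (1 - Cmod q))%R with 0%R by (field; lra).
    rewrite exp_0. lra.
  + simpl qpoch. rewrite Cmod_mult.
    replace (X * (1 - Cmod q ^ S n) / (1 - Cmod q))%R
      with (X * (1 - Cmod q ^ n) / (1 - Cmod q) + X * Cmod q ^ n)%R
      by (simpl; field; lra).
    rewrite exp_plus. apply Rmult_le_compat; try apply Cmod_ge_0; [exact IH|].
    eapply Rle_trans; [|apply exp_ineq1_le].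
    replace (1 - x * q ^ n) with (1 + - (x * q ^ n)) by ring.
    eapply Rle_trans; [apply Cmod_triangle|].
    rewrite Cmod_1, Cmod_opp, Cmod_mult, Cmod_pow.
    apply Rplus_le_compat_l, Rmult_le_compat_r; [now apply pow_le | exact Hx].
- apply exp_le_compat. unfold Rdiv. rewrite Rmult_assoc.
  apply Rmult_le_compat_l; [lra|].
  assert (0 <= Cmod q ^ n)%R by now apply pow_le.
  assert (0 < / (1 - Cmod q))%R by (apply Rinv_0_lt_compat; lra).
  nra.
Qed.

(** Follows from 1/(1-t) = 1 + t/(1-t) <= 1 + t/(1-X) <= exp(t/(1-X)) by taking inverses. *)
Lemma one_minus_exp_lower (t X : R) :
  (0 <= t <= X)%R -> (X < 1)%R -> (exp (- (t / (1 - X))) <= 1 - t)%R.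
Proof.
intros Ht HX. rewrite exp_Ropp.
assert (H : (/ (1 - t) <= exp (t / (1 - X)))%R).
{ eapply Rle_trans; [|apply exp_ineq1_le].
  replace (/ (1 - t))%R with (1 + t / (1 - t))%R by (field; lra).
  apply Rplus_le_compat_l, Rmult_le_compat_l; [lra|].
  apply Rinv_le_contravar; lra. }
rewrite <- (Rinv_inv (1 - t)).
apply Rinv_le_contravar; [apply Rinv_0_lt_compat; lra | exact H].
Qed.

(** Each factor has modulus at least 1 - X |q|^k >= exp(-X |q|^k / (1-X)). The resulting positive
    bound is uniform in [n], so it controls denominators and also keeps the infinite product away
    from 0. *)
Lemma qpoch_lower (x q : C) (X : R) (n : nat) :
  (Cmod q < 1)%R -> (Cmod x <= X)%R -> (X < 1)%R ->
  (exp (- (X / ((1 - X) * (1 - Cmod q)))) <= Cmod (qpoch x q n))%R.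
Proof.
intros Hq Hx HX.
assert (Q0 := Cmod_ge_0 q). assert (X0 := Cmod_ge_0 x).
apply Rle_trans with (exp (- (X * (1 - Cmod q ^ n) / ((1 - X) * (1 - Cmod q))))).
- apply exp_le_compat, Ropp_le_contravar. unfold Rdiv. rewrite Rmult_assoc.
  apply Rmult_le_compat_l; [lra|].
  assert (0 <= Cmod q ^ n)%R by now apply pow_le.
  assert (0 < / ((1 - X) * (1 - Cmod q)))%R by (apply Rinv_0_lt_compat; nra).
  nra.
- induction n as [|n IH].
  + simpl. rewrite Cmod_1.
    replace (X * (1 - 1) / ((1 - X) * (1 - Cmod q)))%R with 0%R
      by (field; lra).
    rewrite Ropp_0, exp_0. lra.
  + simpl qpoch. rewrite Cmod_mult.
    replace (- (X * (1 - Cmod q ^ S n) / ((1 - X) * (1 - Cmod q))))%R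
      with (- (X * (1 - Cmod q ^ n) / ((1 - X) * (1 - Cmod q)))
            + - (X * Cmod q ^ n / (1 - X)))%R by (simpl; field; lra).
    rewrite exp_plus. apply Rmult_le_compat; try (left; apply exp_pos); [exact IH|].
    assert (P0 : (0 <= Cmod q ^ n)%R) by now apply pow_le.
    assert (P1 : (Cmod q ^ n <= 1)%R).
    { rewrite <- (pow1 n). apply pow_incr. lra. }
    eapply Rle_trans; [apply one_minus_exp_lower; [split|]; nra|].
    apply Rle_trans with (1 - Cmod x * Cmod q ^ n)%R; [nra|].
    rewrite <- Cmod_pow, <- Cmod_mult.
    assert (T := Cmod_triangle (1 - x * q ^ n) (x * q ^ n)).
    replace (1 - x * q ^ n + x * q ^ n) with (RtoC 1) in T by ring.
    rewrite Cmod_1 in T. lra.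
Qed.

Lemma qpoch_neq_0 (x q : C) (n : nat) :
  (Cmod q < 1)%R -> (Cmod x < 1)%R -> qpoch x q n <> 0.
Proof.
intros Hq Hx. apply Cmod_gt_0.
eapply Rlt_le_trans; [apply exp_pos|].
exact (qpoch_lower x q (Cmod x) n Hq (Rle_refl _) Hx).
Qed.

(** The differences (x;q)_(n+1) - (x;q)_n = -x q^n (x;q)_n are geometrically small, because (x;q)_n
    is bounded; hence the telescoping series [d] converges. *)
Lemma qpoch_limC (x q : C) : (Cmod q < 1)%R -> exists l, limC (qpoch x q) l.
Proof.
intros Hq.
set (d := fun n => - (x * q ^ n) * qpoch x q n).
destruct (cseries_dominated d
  (Cmod x * exp (Cmod x / (1 - Cmod q)))%R (Cmod q)) as [l Hl].
- split; [apply Cmod_ge_0 | exact Hq].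
- intros n. unfold d. rewrite Cmod_mult, Cmod_opp, Cmod_mult, Cmod_pow.
  assert (H := qpoch_upper x q (Cmod x) n Hq (Rle_refl _)).
  assert (0 <= Cmod x * Cmod q ^ n)%R
    by (apply Rmult_le_pos; [|apply pow_le]; apply Cmod_ge_0).
  nra.
(* The sum of [d] up to index n inclusive reaches (x;q)_(n+1), hence the shift of the sequence. *)
- exists (1 + l). apply limC_S.
  apply limC_ext with (fun n => 1 + csum d n).
  + intros n. induction n as [|n IH].
    * rewrite csum_0. unfold d. simpl. ring.
    * rewrite csum_S, Cplus_assoc, IH. unfold d. simpl. ring.
  + apply limC_plus; [apply limC_const | now apply cseries_limC].
Qed.

Lemma qpoch_limC_neq_0 (x q l : C) :
  (Cmod q < 1)%R -> (Cmod x < 1)%R -> limC (qpoch x q) l -> l <> 0.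
Proof.
intros Hq Hx Hl. apply Cmod_gt_0.
eapply Rlt_le_trans; [apply exp_pos|].
apply limC_Cmod in Hl.
apply (is_lim_seq_le _ _ (Finite _) (Finite _)) with (2 := is_lim_seq_const _) (3 := Hl).
intros n. exact (qpoch_lower x q (Cmod x) n Hq (Rle_refl _) Hx).
Qed.

Lemma qpoch_inf_limC (x q l : C) : limC (qpoch x q) l -> qpoch_inf x q = l.
Proof.
intros H. apply limC_filterlim in H.
apply (@iota_filterlim_locally C_AbsRing C_CompleteNormedModule nat eventually _
  (qpoch x q) l H).
Qed.

(** * Splitting q-shifted factorials, and elementary estimates *)

Lemma qpoch_shift (x q : C) (n : nat) :
  qpoch x q (S n) = (1 - x) * qpoch (x * q) q n.
Proof.
induction n as [|n IH]; [simpl; ring|].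
change (qpoch x q (S (S n))) with (qpoch x q (S n) * (1 - x * q ^ S n)).
rewrite IH. simpl. ring.
Qed.

Lemma qpoch_add (x q : C) (m n : nat) :
  qpoch x q (m + n) = qpoch x q m * qpoch (x * q ^ m) q n.
Proof.
induction n as [|n IH]; [rewrite Nat.add_0_r; simpl; ring|].
rewrite Nat.add_succ_r. simpl. rewrite IH, Cpow_add_r. ring.
Qed.

Lemma one_minus_neq_0 (x : C) : (Cmod x < 1)%R -> 1 - x <> 0.
Proof.
intros H E. replace x with (RtoC 1) in H; [rewrite Cmod_1 in H; lra|].
replace x with (1 - (1 - x)) by ring. rewrite E. ring.
Qed.

Lemma Cmod_mult_pow_le (x q : C) (n : nat) :
  (Cmod q < 1)%R -> (Cmod (x * q ^ n) <= Cmod x)%R.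
Proof.
intros Hq. rewrite Cmod_mult, Cmod_pow.
assert (Q0 := Cmod_ge_0 q). assert (X0 := Cmod_ge_0 x).
assert (Cmod q ^ n <= 1)%R by (rewrite <- (pow1 n); apply pow_incr; lra).
nra.
Qed.

Lemma Cmod_div_bound (x y : C) (M m : R) :
  (Cmod x <= M)%R -> (0 < m)%R -> (m <= Cmod y)%R -> (Cmod (x / y) <= M / m)%R.
Proof.
intros Hx Hm Hy.
rewrite Cmod_div by (apply Cmod_gt_0; lra).
apply Rmult_le_compat; [apply Cmod_ge_0 | | exact Hx | ].
- left. apply Rinv_0_lt_compat. lra.
- now apply Rinv_le_contravar.
Qed.

(** * The q-Gauss sum *)

(* The lower parameter is tied to the argument, [c = z * A * B], so that [c / A]
   and [c / B] become [z * B] and [z * A] and no division is needed. *)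
Definition gauss_term (A B q z : C) (n : nat) : C :=
  qpoch A q n * qpoch B q n / (qpoch q q n * qpoch (z * A * B) q n) * z ^ n.

(** [M] is chosen before [z]: the same constant has to serve for all arguments z q^k in the
    iteration of the contiguous relation. *)
Lemma gauss_term_bound (A B q : C) (X : R) :
  (Cmod q < 1)%R -> (X < 1)%R ->
  exists M : R, forall z n, (Cmod (z * A * B) <= X)%R ->
    (Cmod (gauss_term A B q z n) <= M * Cmod z ^ n)%R.
Proof.
intros Hq HX. eexists. intros z n Hc. unfold gauss_term.
rewrite Cmod_mult, Cmod_pow.
apply Rmult_le_compat_r; [apply pow_le, Cmod_ge_0|].
apply Cmod_div_bound.
- rewrite Cmod_mult. apply Rmult_le_compat; try apply Cmod_ge_0;
    apply qpoch_upper; auto; apply Rle_refl.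
- apply Rmult_lt_0_compat; apply exp_pos.
- rewrite Cmod_mult. apply Rmult_le_compat; try (left; apply exp_pos).
  + exact (qpoch_lower q q _ n Hq (Rle_refl _) Hq).
  + exact (qpoch_lower (z * A * B) q X n Hq Hc HX).
Qed.

(** Replacing z by zq turns c = zAB into cq, so every term involved is a rational multiple of the
    n-th term for z, and the claim becomes a rational identity. The right side has the form g(n) -
    g(n+1). *)
Lemma gauss_term_telescope (A B q z : C) (n : nat) :
  (Cmod q < 1)%R -> (Cmod (z * A * B) < 1)%R ->
  (1 - z * A * B) * (1 - z) * gauss_term A B q z n
  - (1 - z * A) * (1 - z * B) * gauss_term A B q (z * q) n
  = (1 - z * A * B) * (1 - q ^ n) * gauss_term A B q z n
    - (1 - z * A * B) * (1 - q ^ S n) * gauss_term A B q z (S n).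
Proof.
intros Hq Hc. set (c := z * A * B) in *. unfold gauss_term. fold c.
replace (z * q * A * B) with (c * q) by (unfold c; ring).
assert (E := qpoch_shift c q n). simpl in E.
assert (N1 := qpoch_neq_0 q q n Hq Hq).
assert (N2 := qpoch_neq_0 c q n Hq Hc).
assert (N3 : 1 - q * q ^ n <> 0).
{ apply one_minus_neq_0. eapply Rle_lt_trans; [now apply Cmod_mult_pow_le | exact Hq]. }
assert (N4 : 1 - c * q ^ n <> 0).
{ apply one_minus_neq_0. eapply Rle_lt_trans; [now apply Cmod_mult_pow_le | exact Hc]. }
assert (N5 := one_minus_neq_0 c Hc).
assert (E' : qpoch (c * q) q n = qpoch c q n * (1 - c * q ^ n) / (1 - c)).
{ rewrite E. field. exact N5. }
rewrite E', Cpow_mult_l, !Cpow_S. simpl qpoch.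
unfold c. field. repeat split; assumption.
Qed.

Lemma gauss_contiguous (A B q z l l' : C) :
  (Cmod q < 1)%R -> (Cmod z < 1)%R -> (Cmod (z * A * B) < 1)%R ->
  cseries (gauss_term A B q z) l -> cseries (gauss_term A B q (z * q)) l' ->
  (1 - z * A * B) * (1 - z) * l = (1 - z * A) * (1 - z * B) * l'.
Proof.
intros Hq Hz Hc Hl Hl'.
apply cseries_limC in Hl. apply cseries_limC in Hl'.
(* Here g(0) = 0 because of the factor 1 - q^0, and g(n) tends to 0, so the telescoping sum vanishes
   in the limit. *)
set (g := fun n => (1 - z * A * B) * (1 - q ^ n) * gauss_term A B q z n).
assert (Hg : limC g 0).
{ destruct (gauss_term_bound A B q _ Hq Hc) as [M HM].
  apply limC_dominated_0 with (Cmod (1 - z * A * B) * 2 * M)%R (Cmod z).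
  { split; [apply Cmod_ge_0 | exact Hz]. }
  intros n. unfold g. rewrite !Cmod_mult, (Rmult_assoc _ M).
  apply Rmult_le_compat; [ | apply Cmod_ge_0 | | apply HM, Rle_refl].
  - apply Rmult_le_pos; apply Cmod_ge_0.
  - apply Rmult_le_compat_l; [apply Cmod_ge_0|].
    unfold Cminus. eapply Rle_trans; [apply Cmod_triangle|].
    rewrite Cmod_opp, Cmod_1.
    replace (q ^ n) with (1 * q ^ n) by ring.
    assert (H := Cmod_mult_pow_le 1 q n Hq). rewrite Cmod_1 in H. lra. }
assert (H : limC (fun n => 0 - g (S n))
  ((1 - z * A * B) * (1 - z) * l - (1 - z * A) * (1 - z * B) * l')).
{ apply limC_ext with (fun n => (1 - z * A * B) * (1 - z) * csum (gauss_term A B q z) n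
    - (1 - z * A) * (1 - z * B) * csum (gauss_term A B q (z * q)) n).
  - intros n. rewrite <- !csum_scal, <- csum_minus.
    rewrite (csum_ext _ (fun k => g k - g (S k)))
      by (intros k _; exact (gauss_term_telescope A B q z k Hq Hc)).
    induction n as [|n IH]; rewrite ?csum_0, ?csum_S, ?IH.
    + unfold g. simpl. ring.
    + ring.
  - apply limC_minus; now apply limC_scal. }
assert (H0 : limC (fun n => 0 - g (S n)) (0 - 0)).
{ apply limC_minus; [apply limC_const | exact (proj1 (limC_S g 0) Hg)]. }
assert (E := limC_unique _ _ _ H H0).
rewrite <- (Cplus_0_r (_ * _ * l')). replace (RtoC 0) with (0 - 0) by ring.
rewrite <- E. ring.
Qed.

(** With c = zAB this is the classical evaluation (c/A, c/B;q)_inf / (c, c/(AB);q)_inf, the infinite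
    products being given as limits. Iterating the contiguous relation k times produces the four
    finite products; then k tends to infinity. *)
Lemma q_gauss (A B q z pA pB pz pc : C) :
  (Cmod q < 1)%R -> (Cmod z < 1)%R -> (Cmod (z * A * B) < 1)%R ->
  limC (qpoch (z * A) q) pA -> limC (qpoch (z * B) q) pB ->
  limC (qpoch z q) pz -> limC (qpoch (z * A * B) q) pc ->
  cseries (gauss_term A B q z) (pA * pB / (pc * pz)).
Proof.
intros Hq Hz Hc HA HB Hpz Hpc.
destruct (gauss_term_bound A B q _ Hq Hc) as [M HM].
assert (Hzk : forall k, (Cmod (z * q ^ k) <= Cmod z)%R)
  by (intros; now apply Cmod_mult_pow_le).
assert (Hck : forall k, (Cmod (z * q ^ k * A * B) <= Cmod (z * A * B))%R).
{ intros k. replace (z * q ^ k * A * B) with (z * A * B * q ^ k) by ring.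
  now apply Cmod_mult_pow_le. }
set (L := fun k => C_Series (gauss_term A B q (z * q ^ k))).
assert (HL : forall k, cseries (gauss_term A B q (z * q ^ k)) (L k)).
{ intros k. destruct (cseries_dominated (gauss_term A B q (z * q ^ k)) M
    (Cmod (z * q ^ k))) as [l Hl].
  - split; [apply Cmod_ge_0|]. eapply Rle_lt_trans; [apply Hzk | exact Hz].
  - intros n. apply HM, Hck.
  - unfold L. now rewrite (C_Series_correct _ _ Hl). }
assert (Hprod : forall k, qpoch (z * A * B) q k * qpoch z q k * L 0%nat
  = qpoch (z * A) q k * qpoch (z * B) q k * L k).
{ induction k as [|k IH]; [simpl; ring|].
  assert (HS := HL (S k)).
  replace (z * q ^ S k) with (z * q ^ k * q) in HS by (simpl; ring).
  assert (E := gauss_contiguous A B q (z * q ^ k) _ _ Hq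
    (Rle_lt_trans _ _ _ (Hzk k) Hz) (Rle_lt_trans _ _ _ (Hck k) Hc) (HL k) HS).
  simpl qpoch.
  transitivity ((1 - z * q ^ k * A * B) * (1 - z * q ^ k)
    * (qpoch (z * A * B) q k * qpoch z q k * L 0%nat)); [ring|].
  rewrite IH.
  transitivity (qpoch (z * A) q k * qpoch (z * B) q k
    * ((1 - z * q ^ k * A * B) * (1 - z * q ^ k) * L k)); [ring|].
  rewrite E. ring. }
(* As z q^k tends to 0 only the term n = 0, equal to 1, survives: the tail is at most M |z q^k| / (1
   - |z q^k|). *)
assert (HL1 : limC L 1).
{ apply limC_squeeze with (fun k => M * / (1 - Cmod z) * Cmod q ^ k)%R.
  - intros k.
    assert (T := cseries_tail _ _ M (Cmod (z * q ^ k)) 0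
      (conj (Cmod_ge_0 _) (Rle_lt_trans _ _ _ (Hzk k) Hz))
      (fun n => HM _ n (Hck k)) (HL k)).
    rewrite csum_0 in T. unfold gauss_term in T at 1. simpl in T.
    replace (1 * 1 / (1 * 1) * 1) with (RtoC 1) in T by field.
    eapply Rle_trans; [exact T|].
    assert (M0 : (0 <= M)%R).
    { generalize (Cmod_ge_0 (gauss_term A B q z 0)) (HM z 0%nat (Rle_refl _)).
      simpl. lra. }
    rewrite Rmult_1_r. unfold Rdiv. rewrite !Rmult_assoc.
    apply Rmult_le_compat_l; [exact M0|]. rewrite Rmult_comm.
    assert (Hk := Hzk k).
    apply Rmult_le_compat.
    + left. apply Rinv_0_lt_compat. lra.
    + apply Cmod_ge_0.
    + apply Rinv_le_contravar; lra.
    + rewrite Cmod_mult, Cmod_pow.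
      assert (0 <= Cmod q ^ k)%R by apply pow_le, Cmod_ge_0. nra.
  - replace 0%R with (M * / (1 - Cmod z) * 0)%R by ring.
    apply is_lim_seq_mult'; [apply is_lim_seq_const|].
    apply is_lim_seq_geom. rewrite Rabs_pos_eq; [exact Hq | apply Cmod_ge_0]. }
(* Both sides of [Hprod] are the same sequence in k, so their limits agree. *)
assert (E : pc * pz * L 0%nat = pA * pB * 1).
{ apply limC_unique with (fun k => qpoch (z * A * B) q k * qpoch z q k * L 0%nat).
  - apply limC_mult; [now apply limC_mult | apply limC_const].
  - apply limC_ext with (fun k => qpoch (z * A) q k * qpoch (z * B) q k * L k);
      [intros; symmetry; apply Hprod|].
    apply limC_mult; [now apply limC_mult | exact HL1]. }
assert (N1 := qpoch_limC_neq_0 _ _ _ Hq Hz Hpz).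
assert (N2 := qpoch_limC_neq_0 _ _ _ Hq Hc Hpc).
replace (pA * pB / (pc * pz)) with (L 0%nat).
- replace z with (z * q ^ 0) at 1 by (simpl; ring). apply HL.
- replace (pA * pB) with (pc * pz * L 0%nat) by (rewrite E; ring).
  field. now split.
Qed.

(** * The Bailey pair relative to 1 *)

Definition tri (n : nat) : nat := ((n ^ 2 - n) / 2)%nat.

Lemma tri_S (n : nat) : tri (S n) = (tri n + n)%nat.
Proof.
(* Adding n to the quotient adds 2n to the dividend, and (n+1)^2 - (n+1) = n^2 - n + 2n. *)
unfold tri. rewrite <- Nat.div_add by lia. f_equal. simpl. nia.
Qed.

(* The cut-off encodes the convention 1 / (q;q)_(n-r) = 0 for r > n. *)
Definition bailey_kernel (q : C) (n r : nat) : C :=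
  if le_dec r n then / (qpoch q q (n - r) * qpoch q q (n + r)) else 0.

Lemma bailey_kernel_gt (q : C) (n r : nat) : (n < r)%nat -> bailey_kernel q n r = 0.
Proof. intros H. unfold bailey_kernel. destruct le_dec; [lia | reflexivity]. Qed.

(** Writing n = r + m removes both the cut-off and the truncated subtraction. *)
Lemma bailey_kernel_add (q : C) (r m : nat) :
  bailey_kernel q (r + m) r = / (qpoch q q m * qpoch q q (r + m + r)).
Proof.
unfold bailey_kernel. destruct le_dec; [|lia].
now replace (r + m - r)%nat with m by lia.
Qed.

Lemma one_minus_pow_neq_0 (q : C) (n : nat) :
  (Cmod q < 1)%R -> (0 < n)%nat -> 1 - q ^ n <> 0.
Proof.
intros Hq Hn. apply one_minus_neq_0.
destruct n as [|n]; [lia|]. rewrite Cpow_S.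
eapply Rle_lt_trans; [now apply Cmod_mult_pow_le | exact Hq].
Qed.

Lemma qpoch_diag_S (q : C) (n : nat) : qpoch q q (S n) = qpoch q q n * (1 - q ^ S n).
Proof. reflexivity. Qed.

Lemma bailey_kernel_S_l (q : C) (n r : nat) :
  (Cmod q < 1)%R -> (r <= S n)%nat ->
  bailey_kernel q n r
  = bailey_kernel q (S n) r * (1 - q ^ (S n - r)) * (1 - q ^ (S n + r)).
Proof.
intros Hq Hr.
(* At r = n + 1 both sides are 0: the left by the cut-off, the right by the factor 1 - q^0. *)
destruct (Nat.eq_dec r (S n)) as [->|Hr'].
- rewrite bailey_kernel_gt, Nat.sub_diag by lia. simpl (q ^ 0). ring.
- replace n with (r + (n - r))%nat by lia.
  set (m := (n - r)%nat). replace (S (r + m)) with (r + S m)%nat by lia.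
  rewrite !bailey_kernel_add.
  replace (r + S m - r)%nat with (S m) by lia.
  replace (r + S m + r)%nat with (S (r + m + r)) by lia.
  assert (N1 := qpoch_neq_0 q q m Hq Hq).
  assert (N2 := qpoch_neq_0 q q (r + m + r) Hq Hq).
  assert (N3 := one_minus_pow_neq_0 q (S m) Hq ltac:(lia)).
  assert (N4 := one_minus_pow_neq_0 q (S (r + m + r)) Hq ltac:(lia)).
  rewrite !qpoch_diag_S. field. repeat split; assumption.
Qed.

Lemma bailey_kernel_S_r (q : C) (n r : nat) :
  (Cmod q < 1)%R -> (r < n)%nat ->
  bailey_kernel q n r * (1 - q ^ (n - r))
  = bailey_kernel q n (S r) * (1 - q ^ (n + S r)).
Proof.
intros Hq Hr.
assert (E : exists m, n = (r + S m)%nat) by (exists (n - r - 1)%nat; lia).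
destruct E as [m ->].
rewrite bailey_kernel_add.
replace (r + S m)%nat with (S r + m)%nat by lia.
rewrite bailey_kernel_add.
replace (S r + m - r)%nat with (S m) by lia.
replace (S r + m + S r)%nat with (S (S r + m + r)) by lia.
assert (N1 := qpoch_neq_0 q q m Hq Hq).
assert (N2 := qpoch_neq_0 q q (S r + m + r) Hq Hq).
assert (N3 := one_minus_pow_neq_0 q (S m) Hq ltac:(lia)).
assert (N4 := one_minus_pow_neq_0 q (S (S r + m + r)) Hq ltac:(lia)).
rewrite !qpoch_diag_S. field. repeat split; assumption.
Qed.

Lemma bailey_kernel_bound (q : C) :
  (Cmod q < 1)%R -> exists M, forall n r, (Cmod (bailey_kernel q n r) <= M)%R.
Proof.
intros Hq.
set (e := exp (- (Cmod q / ((1 - Cmod q) * (1 - Cmod q))))).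
assert (He : (0 < e * e)%R) by (apply Rmult_lt_0_compat; apply exp_pos).
exists (1 / (e * e))%R. intros n r.
unfold bailey_kernel. destruct le_dec.
- replace (/ (qpoch q q (n - r) * qpoch q q (n + r)))
    with (1 / (qpoch q q (n - r) * qpoch q q (n + r))).
  + apply Cmod_div_bound; [rewrite Cmod_1; lra | exact He |].
    rewrite Cmod_mult.
    apply Rmult_le_compat; try (left; apply exp_pos);
      exact (qpoch_lower q q _ _ Hq (Rle_refl _) Hq).
  + unfold Cdiv. ring.
- rewrite Cmod_0. unfold Rdiv. rewrite Rmult_1_l. left. now apply Rinv_0_lt_compat.
Qed.

(* The value 1 at [r = 0] is half of what the general formula gives: the sums over
   [r >= 0] are halves of sums over all integers, symmetric under [r -> -r].  The
   same folding produces [bailey_alpha]. *)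
Definition alternating_coeff (q : C) (r : nat) : C :=
  match r with
  | O => 1
  | S _ => (- (1)) ^ r * q ^ tri r * (1 + q ^ r)
  end.

Definition bailey_alpha (q : C) (r : nat) : C :=
  match r with
  | O => 1
  | S _ => 4 * (- (1)) ^ r * q ^ (tri r + r) / (1 + q ^ r)
  end.

(** A closed form for all partial sums makes the induction on [j] possible; its step rests on (1 +
    Q)(1 - q^m) - (1 - q^m Q) = Q - q^m with Q = q^(j+1). The case of interest is j = m, where the
    factor 1 - q^(m-j) vanishes. *)
Lemma alternating_kernel_sum (q : C) (m j : nat) :
  (Cmod q < 1)%R -> (0 < m)%nat -> (j <= m)%nat ->
  csum (fun r => alternating_coeff q r * bailey_kernel q m r) j
  = (- (1)) ^ j * q ^ (tri j + j) * (1 - q ^ (m - j)) / (1 - q ^ m)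
    * bailey_kernel q m j.
Proof.
intros Hq Hm Hj.
assert (N := one_minus_pow_neq_0 q m Hq Hm).
induction j as [|j IH].
- rewrite csum_0, Nat.sub_0_r. simpl. field. exact N.
- rewrite csum_S, IH by lia.
  transitivity ((- (1)) ^ j * q ^ (tri j + j) / (1 - q ^ m)
    * (bailey_kernel q m j * (1 - q ^ (m - j)))
    + alternating_coeff q (S j) * bailey_kernel q m (S j)); [field; exact N|].
  rewrite bailey_kernel_S_r by (assumption || lia).
  unfold alternating_coeff. rewrite tri_S, (Cpow_add_r q (tri j + j) (S j)).
  rewrite (Cpow_add_r q m (S j)).
  replace (q ^ m) with (q ^ S j * q ^ (m - S j))
    by (rewrite <- Cpow_add_r; f_equal; lia).
  rewrite (Cpow_S (- (1)) j). field.
  rewrite <- Cpow_add_r. replace (S j + (m - S j))%nat with m by lia. exact N.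
Qed.

Lemma one_plus_pow_neq_0 (q : C) (n : nat) :
  (Cmod q < 1)%R -> (0 < n)%nat -> 1 + q ^ n <> 0.
Proof.
intros Hq Hn. replace (1 + q ^ n) with (1 - - (q ^ n)) by ring.
apply one_minus_neq_0. rewrite Cmod_opp.
destruct n as [|n]; [lia|]. rewrite Cpow_S.
eapply Rle_lt_trans; [now apply Cmod_mult_pow_le | exact Hq].
Qed.

Lemma bailey_pair (q : C) (n : nat) :
  (Cmod q < 1)%R ->
  csum (fun r => bailey_alpha q r * bailey_kernel q n r) n
  = / (qpoch (- q) q n * qpoch (- q) q n).
Proof.
intros Hq.
assert (Hq' : (Cmod (- q) < 1)%R) by now rewrite Cmod_opp.
induction n as [|n IH].
- rewrite csum_0. unfold bailey_kernel. simpl. field.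
- assert (N := one_plus_pow_neq_0 q (S n) Hq ltac:(lia)).
  assert (N' := qpoch_neq_0 (- q) q n Hq Hq').
  (* The range of the old sum can be extended to n + 1, since the cut-off makes the added term 0;
     both sums then have the same range. *)
  assert (IH' : csum (fun r => bailey_alpha q r * bailey_kernel q n r) (S n)
    = / (qpoch (- q) q n * qpoch (- q) q n)).
  { rewrite csum_S, IH, bailey_kernel_gt by lia. ring. }
  (* With N = n + 1, termwise comparison uses (1 + q^N)^2 - (1 - q^(N-r))(1 - q^(N+r)) = q^(N-r) (1
     + q^r)^2; one factor 1 + q^r cancels the denominator of [bailey_alpha]. *)
  assert (E : (1 + q ^ S n) * (1 + q ^ S n)
      * csum (fun r => bailey_alpha q r * bailey_kernel q (S n) r) (S n)
      - csum (fun r => bailey_alpha q r * bailey_kernel q n r) (S n)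
    = 4 * q ^ S n
      * csum (fun r => alternating_coeff q r * bailey_kernel q (S n) r) (S n)).
  { rewrite <- !csum_scal, <- csum_minus. apply csum_ext. intros r Hr.
    rewrite (bailey_kernel_S_l q n r Hq Hr), (Cpow_add_r q (S n) r).
    destruct r as [|r].
    - rewrite Nat.sub_0_r. simpl. ring.
    - unfold bailey_alpha, alternating_coeff.
      assert (Nr := one_plus_pow_neq_0 q (S r) Hq ltac:(lia)).
      replace (q ^ S n) with (q ^ S r * q ^ (S n - S r))
        by (rewrite <- Cpow_add_r; f_equal; lia).
      rewrite (Cpow_add_r q (tri (S r))). field. exact Nr. }
  (* The complete alternating sum carries the factor 1 - q^0, so the right side of [E] is 0. *)
  rewrite alternating_kernel_sum, IH', Nat.sub_diag in E by (assumption || lia).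
  simpl (q ^ 0) in E.
  assert (E2 : (1 + q ^ S n) * (1 + q ^ S n)
      * csum (fun r => bailey_alpha q r * bailey_kernel q (S n) r) (S n)
    = / (qpoch (- q) q n * qpoch (- q) q n)).
  { rewrite <- (Cplus_0_r (/ _)).
    match type of E with _ = ?R => replace (RtoC 0) with R at 1 end.
    - rewrite <- E. ring.
    - unfold Cdiv. ring. }
  change (qpoch (- q) q (S n)) with (qpoch (- q) q n * (1 - - q * q ^ n)).
  replace (1 - - q * q ^ n) with (1 + q ^ S n) by (simpl; ring).
  match goal with |- ?x = _ =>
    replace x with ((1 + q ^ S n) * (1 + q ^ S n) * x
      / ((1 + q ^ S n) * (1 + q ^ S n))) by (field; exact N) end.
  rewrite E2. field. now split.
Qed.

(** Of the power q^(tri r + r) only q^r is kept, which already gives geometric decay; the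
    denominator is bounded below by 1 - |q|. *)
Lemma bailey_alpha_bound (q : C) (r : nat) :
  (Cmod q < 1)%R ->
  (Cmod (bailey_alpha q r) <= 4 / (1 - Cmod q) * Cmod q ^ r)%R.
Proof.
intros Hq. assert (Q0 := Cmod_ge_0 q).
destruct r as [|r].
- simpl. rewrite Cmod_1, Rmult_1_r.
  apply (Rmult_le_reg_r (1 - Cmod q)); [lra|].
  unfold Rdiv. rewrite Rmult_assoc, Rinv_l by lra. lra.
- unfold bailey_alpha.
  apply Rle_trans with (4 * Cmod q ^ S r / (1 - Cmod q))%R;
    [|apply Req_le; unfold Rdiv; ring].
  apply Cmod_div_bound; [|lra|].
  + rewrite !Cmod_mult, !Cmod_pow, Cmod_m1, pow1, Rmult_1_r, Cmod_R, Rabs_pos_eq by lra.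
    apply Rmult_le_compat_l; [lra|].
    rewrite pow_add.
    assert (0 <= Cmod q ^ S r)%R by now apply pow_le.
    assert (Cmod q ^ tri (S r) <= 1)%R by (rewrite <- (pow1 (tri (S r))); apply pow_incr; lra).
    nra.
  + assert (H := Cmod_mult_pow_le q q r Hq). rewrite <- Cpow_S in H.
    assert (T := Cmod_triangle (1 + q ^ S r) (- q ^ S r)).
    replace (1 + q ^ S r + - q ^ S r) with (RtoC 1) in T by ring.
    rewrite Cmod_opp, Cmod_1 in T. lra.
Qed.

(** * Interchange of summations and the inner sums of Bailey's lemma *)

Lemma csum_bound (u : nat -> C) (M r : R) (n : nat) :
  (0 <= r < 1)%R -> (forall n, Cmod (u n) <= M * r ^ n)%R ->
  (Cmod (csum u n) <= M / (1 - r))%R.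
Proof.
intros Hr Hu.
assert (H := csum_dominated u M r 0 n Hr Hu).
assert (H0 := Hu 0%nat). rewrite csum_0 in H. simpl in H, H0.
replace (csum u n) with (csum u n - u 0%nat + u 0%nat) by ring.
eapply Rle_trans; [apply Cmod_triangle|].
replace (M / (1 - r))%R with (M * (r * 1) / (1 - r) + M * 1)%R by (field; lra).
lra.
Qed.

(* The tails of the inner series are geometric uniformly in [r], which is what
   makes the interchange of the two summations legitimate. *)
Lemma cseries_exchange (al ga : nat -> C) (w : nat -> nat -> C)
    (Ma s M rho : R) (S : C) :
  (0 <= s < 1)%R -> (0 <= rho < 1)%R ->
  (forall r, Cmod (al r) <= Ma * s ^ r)%R ->
  (forall n r, Cmod (w n r) <= M * rho ^ n)%R ->
  (forall n r, (n < r)%nat -> w n r = 0) ->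
  (forall r, cseries (fun n => w n r) (ga r)) ->
  cseries (fun r => al r * ga r) S ->
  cseries (fun n => csum (fun r => al r * w n r) n) S.
Proof.
intros Hs Hrho Hal Hw Hw0 Hga HS.
apply cseries_limC. apply cseries_limC in HS.
(* Since w n r = 0 for r > n, the triangle r <= n <= N may be enlarged to a square, where finite
   sums commute. *)
assert (Hswitch : forall N, csum (fun n => csum (fun r => al r * w n r) n) N
  = csum (fun r => al r * csum (fun n => w n r) N) N).
{ intros N.
  transitivity (csum (fun n => csum (fun r => al r * w n r) N) N).
  - apply csum_ext. intros n Hn.
    induction N as [|N IH]; [now replace n with 0%nat by lia|].
    destruct (Nat.eq_dec n (Datatypes.S N)) as [->|Hne]; [reflexivity|].
    rewrite csum_S, Hw0, IH by lia. ring.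
  - transitivity (csum (fun r => csum (fun n => al r * w n r) N) N).
    + exact (@sum_n_switch C_NormedModule (fun n r => al r * w n r) N N).
    + apply csum_ext. intros r _. apply csum_scal. }
(* The difference of the two partial sums is the sum over r <= N of al r times the tail of the r-th
   inner series, hence of order rho^N. *)
assert (Hdiff : limC (fun N => csum (fun r => al r * ga r) N
    - csum (fun n => csum (fun r => al r * w n r) n) N) 0).
{ apply limC_dominated_0 with (Ma * (M * rho / (1 - rho)) / (1 - s))%R rho;
    [exact Hrho|].
  intros N. rewrite Hswitch, <- csum_minus.
  eapply Rle_trans.
  - apply (csum_bound _ (Ma * (M * rho ^ Datatypes.S N / (1 - rho))) s); [exact Hs|].
    intros r. replace (al r * ga r - al r * csum (fun n => w n r) N)
      with (al r * (ga r - csum (fun n => w n r) N)) by ring.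
    rewrite Cmod_mult.
    replace (Ma * (M * rho ^ Datatypes.S N / (1 - rho)) * s ^ r)%R
      with ((Ma * s ^ r) * (M * rho ^ Datatypes.S N / (1 - rho)))%R by ring.
    apply Rmult_le_compat; try apply Cmod_ge_0; [apply Hal|].
    apply cseries_tail; [exact Hrho | intros n; apply Hw | apply Hga].
  - apply Req_le. simpl. field. lra. }
replace S with (S - 0) by ring.
eapply limC_ext; [|exact (limC_minus _ _ _ _ HS Hdiff)].
intros N. simpl. ring.
Qed.

Lemma qpoch_limC_shift (x q l : C) (r : nat) :
  qpoch x q r <> 0 -> limC (qpoch x q) l ->
  limC (qpoch (x * q ^ r) q) (l / qpoch x q r).
Proof.
intros Hr Hl.
apply limC_ext with (fun n => / qpoch x q r * qpoch x q (n + r)).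
- intros n. rewrite Nat.add_comm, qpoch_add. field. exact Hr.
- replace (l / qpoch x q r) with (/ qpoch x q r * l) by (unfold Cdiv; ring).
  apply limC_scal.
  now apply (is_lim_seq_incr_n (fun n => Cmod (qpoch x q n - l)) r 0%R).
Qed.

Lemma cseries_scal (c : C) (u : nat -> C) (l : C) :
  cseries u l -> cseries (fun n => c * u n) (c * l).
Proof.
rewrite !cseries_limC. intros H.
apply limC_ext with (fun n => c * csum u n); [intros n; now rewrite csum_scal|].
now apply limC_scal.
Qed.

Lemma cseries_ext (u v : nat -> C) (l : C) :
  (forall n, u n = v n) -> cseries u l -> cseries v l.
Proof. exact (is_series_ext u v l). Qed.

Lemma cseries_shift_zeros (u : nat -> C) (l : C) (r : nat) :
  (forall n, (n < r)%nat -> u n = 0) ->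
  cseries (fun n => u (r + n)%nat) l -> cseries u l.
Proof.
intros Hu Hl. destruct r as [|r]; [exact Hl|].
apply (is_series_decr_n u (S r) l); [lia|]. simpl Nat.pred.
match goal with |- is_series _ ?L => replace L with l; [exact Hl|] end.
change (l = l + - csum u r).
replace (csum u r) with (RtoC 0); [ring|].
assert (H : forall k, (k <= r)%nat -> csum u k = 0).
{ induction k as [|k IH]; intros Hk.
  - rewrite csum_0. apply Hu. lia.
  - rewrite csum_S, IH, Hu by lia. ring. }
symmetry. now apply H.
Qed.

Lemma cseries_S (u : nat -> C) (l : C) :
  cseries u l -> cseries (fun n => u (S n)) (l - u 0%nat).
Proof.
intros H. apply (is_series_incr_1 u).
match goal with |- is_series _ ?L => replace L with l; [exact H|] end.
change (l = l - u 0%nat + u 0%nat). ring.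
Qed.

(* The sums over [n] occurring in Bailey's lemma, evaluated by the q-Gauss sum
   with parameters [A q^r], [B q^r]. *)
Lemma bailey_kernel_series (A B q z pA pB pz pq : C) (r : nat) :
  (Cmod q < 1)%R -> (Cmod z < 1)%R -> z * A * B = q ->
  (Cmod (z * A) < 1)%R -> (Cmod (z * B) < 1)%R ->
  limC (qpoch (z * A) q) pA -> limC (qpoch (z * B) q) pB ->
  limC (qpoch z q) pz -> limC (qpoch q q) pq ->
  cseries (fun n => qpoch A q n * qpoch B q n * z ^ n * bailey_kernel q n r)
    (pA * pB / (pq * pz)
     * (qpoch A q r * qpoch B q r * z ^ r
        / (qpoch (z * A) q r * qpoch (z * B) q r))).
Proof.
intros Hq Hz HAB HzA HzB HA HB Hpz Hpq.
assert (NA := qpoch_neq_0 _ _ r Hq HzA).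
assert (NB := qpoch_neq_0 _ _ r Hq HzB).
assert (Nq := qpoch_neq_0 q q (r + r) Hq Hq).
assert (Npz := qpoch_limC_neq_0 _ _ _ Hq Hz Hpz).
assert (Npq := qpoch_limC_neq_0 _ _ _ Hq Hq Hpq).
(* The shifted lower parameter is q^(2r+1), which matches (q;q)_(2r+n) = (q;q)_(2r) (q^(2r+1);q)_n
   in the kernel at index r + n. *)
assert (Ec : z * (A * q ^ r) * (B * q ^ r) = q * q ^ (r + r)).
{ rewrite Cpow_add_r. rewrite <- HAB at 3. ring. }
assert (Hc : (Cmod (q * q ^ (r + r)) < 1)%R).
{ eapply Rle_lt_trans; [now apply Cmod_mult_pow_le | exact Hq]. }
assert (G := q_gauss (A * q ^ r) (B * q ^ r) q z
  (pA / qpoch (z * A) q r) (pB / qpoch (z * B) q r) pz (pq / qpoch q q (r + r)) Hq Hz).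
rewrite Ec, !Cmult_assoc in G.
specialize (G Hc (qpoch_limC_shift _ _ _ r NA HA) (qpoch_limC_shift _ _ _ r NB HB)
  Hpz (qpoch_limC_shift _ _ _ (r + r) Nq Hpq)).
apply (cseries_shift_zeros _ _ r).
{ intros n Hn. rewrite bailey_kernel_gt by exact Hn. ring. }
(* The constant is the term n = r of the original series, factored out so that the remaining series
   starts with 1. *)
apply cseries_scal
  with (c := qpoch A q r * qpoch B q r * z ^ r / qpoch q q (r + r)) in G.
match goal with |- cseries _ ?L => match type of G with cseries _ ?L' =>
  replace L with L' by (field; repeat split; assumption) end end.
eapply cseries_ext; [|exact G].
intros n. cbv beta. unfold gauss_term. rewrite Ec, bailey_kernel_add.
replace (r + n + r)%nat with (r + r + n)%nat by lia.
rewrite !(qpoch_add _ _ r n), (qpoch_add _ _ (r + r) n), (Cpow_add_r z).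
assert (N1 := qpoch_neq_0 q q n Hq Hq).
assert (N2 := qpoch_neq_0 _ _ n Hq Hc).
field. repeat split; assumption.
Qed.

(** * The identity, from Bailey's lemma with A = q/a, B = q/b, z = ab/q *)

Theorem theorem4p9 (q a b : C)
  (hq0 : q <> 0) (ha0 : a <> 0) (hb0 : b <> 0)
  (hq : (Cmod q < 1)%R)
  (hmax : (Rmax (Rmax (Cmod (a * b / q)) (Cmod a)) (Cmod b) < 1)%R) :
  (ex_qpoch_inf q q /\ ex_qpoch_inf (a * b / q) q /\
   ex_qpoch_inf a q /\ ex_qpoch_inf b q) /\
  @ex_series C_AbsRing C_NormedModule
    (phi32_term (q / a) (q / b) q (- q) (- q) q (a * b / q)) /\
  @ex_series C_AbsRing C_NormedModule (fun n : nat => rhs_term q a b (S n)) /\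
  (qpoch_inf q q * qpoch_inf (a * b / q) q)
    / (qpoch_inf a q * qpoch_inf b q)
    * phi32 (q / a) (q / b) q (- q) (- q) q (a * b / q)
  = 1 + 4 * C_Series (fun n : nat => rhs_term q a b (S n)).
Proof.
set (z := a * b / q). set (A := q / a). set (B := q / b).
assert (Hz : (Cmod z < 1)%R).
{ eapply Rle_lt_trans; [|exact hmax]. eapply Rle_trans; apply Rmax_l. }
assert (Ha : (Cmod a < 1)%R).
{ eapply Rle_lt_trans; [|exact hmax]. eapply Rle_trans; [apply Rmax_r | apply Rmax_l]. }
assert (Hb : (Cmod b < 1)%R).
{ eapply Rle_lt_trans; [|exact hmax]. apply Rmax_r. }
assert (Hq' : (Cmod (- q) < 1)%R) by now rewrite Cmod_opp.
assert (EA : z * A = b) by (unfold z, A; field; now split).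
assert (EB : z * B = a) by (unfold z, B; field; now split).
assert (EAB : z * A * B = q) by (unfold z, A, B; field; now repeat split).
destruct (qpoch_limC q q hq) as [pq Hpq].
destruct (qpoch_limC z q hq) as [pz Hpz].
destruct (qpoch_limC a q hq) as [pa Hpa].
destruct (qpoch_limC b q hq) as [pb Hpb].
assert (Npq := qpoch_limC_neq_0 _ _ _ hq hq Hpq).
assert (Npz := qpoch_limC_neq_0 _ _ _ hq Hz Hpz).
assert (Npa := qpoch_limC_neq_0 _ _ _ hq Ha Hpa).
assert (Npb := qpoch_limC_neq_0 _ _ _ hq Hb Hpb).
split.
{ repeat split; [exists pq | exists pz | exists pa | exists pb];
    now apply limC_filterlim. }
(* [K] is the reciprocal of the prefactor of the 3phi2 series. *)
set (K := pb * pa / (pq * pz)).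
assert (NK : K <> 0).
{ intros E. apply (Cmult_neq_0 _ _ Npb Npa).
  replace (pb * pa) with (K * (pq * pz)) by (unfold K; field; now split).
  rewrite E. ring. }
(* This is the sequence gamma_r of Bailey's lemma that is conjugate to delta_n = (A;q)_n (B;q)_n
   z^n. *)
set (gam := fun r => K * (qpoch A q r * qpoch B q r * z ^ r
  / (qpoch b q r * qpoch a q r))).
assert (Hgam : forall r, cseries
  (fun n => qpoch A q n * qpoch B q n * z ^ n * bailey_kernel q n r) (gam r)).
{ intros r. unfold gam, K. rewrite <- EA, <- EB.
  apply bailey_kernel_series; first [assumption | rewrite EA; assumption | rewrite EB; assumption]. }
destruct (bailey_kernel_bound q hq) as [Mk HMk].
set (EAu := exp (Cmod A / (1 - Cmod q))).
set (EBu := exp (Cmod B / (1 - Cmod q))).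
assert (HAB : forall n, (Cmod (qpoch A q n * qpoch B q n) <= EAu * EBu)%R).
{ intros n. rewrite Cmod_mult. apply Rmult_le_compat; try apply Cmod_ge_0;
    apply qpoch_upper; auto; apply Rle_refl. }
assert (Hw : forall n r,
  (Cmod (qpoch A q n * qpoch B q n * z ^ n * bailey_kernel q n r)
   <= EAu * EBu * Mk * Cmod z ^ n)%R).
{ intros n r. rewrite (Cmod_mult _ (bailey_kernel q n r)), (Cmod_mult _ (z ^ n)), Cmod_pow.
  replace (EAu * EBu * Mk * Cmod z ^ n)%R
    with (EAu * EBu * Cmod z ^ n * Mk)%R by ring.
  apply Rmult_le_compat; try apply Cmod_ge_0; [| |apply HMk].
  - apply Rmult_le_pos; [|apply pow_le]; apply Cmod_ge_0.
  - apply Rmult_le_compat_r; [apply pow_le, Cmod_ge_0 | apply HAB]. }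
assert (Hw0 : forall n r, (n < r)%nat ->
  qpoch A q n * qpoch B q n * z ^ n * bailey_kernel q n r = 0).
{ intros n r Hn. rewrite bailey_kernel_gt by exact Hn. ring. }
assert (Iq : (0 <= Cmod q < 1)%R) by (split; [apply Cmod_ge_0 | exact hq]).
assert (Iz : (0 <= Cmod z < 1)%R) by (split; [apply Cmod_ge_0 | exact Hz]).
(* [gam] is bounded uniformly in r, as a limit of partial sums with a common geometric majorant, and
   [bailey_alpha] decays geometrically. *)
assert (HS : exists S, cseries (fun r => bailey_alpha q r * gam r) S).
{ apply (cseries_dominated _
    (4 / (1 - Cmod q) * (EAu * EBu * Mk / (1 - Cmod z)))%R (Cmod q) Iq).
  intros r. rewrite Cmod_mult.
  replace (4 / (1 - Cmod q) * (EAu * EBu * Mk / (1 - Cmod z)) * Cmod q ^ r)%R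
    with (4 / (1 - Cmod q) * Cmod q ^ r * (EAu * EBu * Mk / (1 - Cmod z)))%R by ring.
  apply Rmult_le_compat; try apply Cmod_ge_0; [now apply bailey_alpha_bound|].
  specialize (Hgam r). apply cseries_limC, limC_Cmod in Hgam.
  apply (is_lim_seq_le _ _ (Finite _) (Finite _)) with (2 := Hgam)
    (3 := is_lim_seq_const (EAu * EBu * Mk / (1 - Cmod z))%R).
  intros n. apply csum_bound; [exact Iz | intros k; apply Hw]. }
destruct HS as [S HS].
(* The third upper parameter q cancels (q;q)_n, leaving delta_n / (-q;q)_n^2, into which the Bailey
   pair is inserted. *)
assert (Hphi : cseries (phi32_term A B q (- q) (- q) q z) S).
{ eapply cseries_ext; [|exact (cseries_exchange _ _ _ _ _ _ _ _ Iq Iz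
    (fun r => bailey_alpha_bound q r hq) Hw
    Hw0 Hgam HS)].
  intros n. cbv beta.
  rewrite (csum_ext _ (fun r => qpoch A q n * qpoch B q n * z ^ n
    * (bailey_alpha q r * bailey_kernel q n r))) by (intros; ring).
  rewrite csum_scal, bailey_pair by exact hq.
  assert (N1 := qpoch_neq_0 q q n hq hq).
  assert (N2 := qpoch_neq_0 (- q) q n hq Hq').
  unfold phi32_term. field. now split. }
(* The term r = 0 of the series for [S] is [K], and each later term is 4K times the corresponding
   [rhs_term]; thus S / K is the right side of the theorem. *)
assert (Hrhs : cseries (fun n => rhs_term q a b (Datatypes.S n)) (/ (4 * K) * (S - K))).
{ assert (E0 : bailey_alpha q 0 * gam 0%nat = K).
  { unfold gam. simpl. field. }
  assert (HS1 := cseries_S _ _ HS). cbv beta in HS1. rewrite E0 in HS1.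
  eapply cseries_ext; [|exact (cseries_scal (/ (4 * K)) _ _ HS1)].
  intros n. cbv beta. set (m := Datatypes.S n).
  change (bailey_alpha q m) with (4 * (- (1)) ^ m * q ^ (tri m + m) / (1 + q ^ m)).
  unfold gam, rhs_term. fold A B (tri m).
  assert (N1 := one_plus_pow_neq_0 q m hq ltac:(lia)).
  assert (N2 := qpoch_neq_0 _ _ m hq Ha).
  assert (N3 := qpoch_neq_0 _ _ m hq Hb).
  (* Since ab = zq, the product (-ab)^m q^(tri m) splits into z^m from [gam] and (-1)^m q^(tri m +
     m) from [bailey_alpha]. *)
  replace (- (a * b)) with (- (1) * (z * q)) by (unfold z; field; assumption).
  rewrite !Cpow_mult_l, Cpow_add_r.
  field. repeat split; assumption. }
split; [now exists S|]. split; [now eexists; exact Hrhs|].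
rewrite (qpoch_inf_limC _ _ _ Hpq), (qpoch_inf_limC _ _ _ Hpz),
  (qpoch_inf_limC _ _ _ Hpa), (qpoch_inf_limC _ _ _ Hpb).
unfold phi32. rewrite (C_Series_correct _ _ Hphi), (C_Series_correct _ _ Hrhs).
unfold K. field. repeat split; assumption.
Qed.
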